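(* Let $(\mathbf{C},\otimes,I)$ be a small strict monoidal category, $R:\mathbf{C}\to\mathbf{Vect}$ a strict monoidal functor, $\mathcal{F}$ a system of fields and $\mathbb{T}$ a system of $\mathbf{C}$-valued action exponentials. The $R$-linearization $\mathbb{L}$ of $\mathbb{T}$, given on a bordism $W$ by the composition $$\mathbb{L}_W:\mathcal{F}(W)\xrightarrow{\ \mathbb{T}_W\ }\operatorname{Mor}(\mathbf{C})\xrightarrow{\ R\ }\operatorname{Mor}(\mathbf{Vect}),$$ is a system of $\mathbf{Vect}$-valued action exponentials.
   Context: $\mathbf{Vect}$ is the category of vector spaces over a fixed field with linear maps as morphisms, endowed with a strict monoidal structure: the Schauenburg tensor product $\odot$ (written $\otimes$), with unit object the ground field. This product is strictly associative and strictly unital on the same category $\mathbf{Vect}$, and there is a natural isomorphism from the usual tensor product to $\odot$ making the identity functor a monoidal equivalence from the usual monoidal structure to this strict one. Fix an integer $n\ge 0$. Manifolds are topological and need not be orientable; $\varnothing$ is a manifold of every dimension; $\sqcup$ is the ordered disjoint union. A bordism from $M$ to $N$ is a triple $(W,M,N)$ (often abbreviated $W$) with $W$ a compact $(n+1)$-dimensional topological manifold, $\partial W=M\sqcup N$, where the closed $n$-manifolds $M,N$ are the incoming and outgoing boundary. $(W,M,N)\sqcup(W',M',N')=(W\sqcup W',M\sqcup M',N\sqcup N')$. If $W'$ is a bordism from $M$ to $N$ and $W''$ a bordism from $N$ to $P$, gluing along $N$ yields the bordism $W'\cup_N W''$ from $M$ to $P$. A homeomorphism of bordisms is a homeomorphism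 preserving incoming and outgoing boundaries. $(W_0,M_0,N_0)$ is a subbordism of $(W,M,N)$ if $W_0\subset W$ is a codimension $0$ submanifold, every connected component $C$ of $M_0$ satisfies $C\cap\partial W=\varnothing$ or $C\subset M$, and every connected component $C$ of $N_0$ satisfies $C\cap\partial W=\varnothing$ or $C\subset N$. A system $\mathcal{F}$ of fields assigns to each bordism $W$ a set $\mathcal{F}(W)$ and to each closed $n$-manifold $M$ a set $\mathcal{F}(M)$, with $\mathcal{F}(\varnothing)$ a one-element set, such that: (FRES) There are restriction maps $\mathcal{F}(W)\to\mathcal{F}(W_0)$ for subbordisms $W_0\subset W$, $\mathcal{F}(M)\to\mathcal{F}(M_0)$ for codimension $0$ submanifolds $M_0\subset M$, and $\mathcal{F}(W)\to\mathcal{F}(M)$ for closed codimension $1$ submanifolds $M\subset W$; they are written $f\mapsto f|_{(-)}$ and commute with each other in the obvious way (restricting in stages equals restricting directly). (FHOMEO) A homeomorphism of bordisms $\phi:W\to W'$ induces a bijection $\phi^*:\mathcal{F}(W')\to\mathcal{F}(W)$ with $(\operatorname{id}_W)^*=\operatorname{id}$, $(\psi\circ\phi)^*=\phi^*\circ\psi^*$; similarly for homeomorphisms of closed $n$-manifolds; these maps commute with the restriction maps. (FDISJ) The products of restrictions $\mathcal{F}(W\sqcup W')\to\mathcal{F}(W)\times\mathcal{F}(W')$ and $\mathcal{F}(M\sqcup N)\to\mathcal{F}(M)\times\mathcal{F}(N)$ are bijections. (FGLUE) For $W=W'\cup_N W''$, the map $\mathcal{F}(W)\to\mathcal{F}(W')\times_{\mathcal{F}(N)}\mathcal{F}(W'')$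 given by the restrictions to $W'$ and $W''$ is a bijection onto the pullback. For a strict monoidal category $(\mathbf{D},\otimes,I)$, a system $\mathbb{T}$ of $\mathbf{D}$-valued action exponentials consists of functions $\mathbb{T}_W:\mathcal{F}(W)\to\operatorname{Mor}(\mathbf{D})$ for all bordisms $W$ with $\mathbb{T}_\varnothing(p)=\operatorname{id}_I$ ($p$ the unique element of $\mathcal{F}(\varnothing)$) such that: (TDISJ) $\mathbb{T}_{W\sqcup W'}(f)=\mathbb{T}_W(f|_W)\otimes\mathbb{T}_{W'}(f|_{W'})$ for all $f\in\mathcal{F}(W\sqcup W')$; (TGLUE) for $W=W'\cup_NW''$ and $f\in\mathcal{F}(W)$, $\mathbb{T}_W(f)=\mathbb{T}_{W''}(f|_{W''})\circ\mathbb{T}_{W'}(f|_{W'})$; (THOMEO) for a homeomorphism of bordisms $\phi:W\to W'$ and $f\in\mathcal{F}(W')$, $\mathbb{T}_W(\phi^*f)=\mathbb{T}_{W'}(f)$. *)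

(* Defs.v *)
From HB Require Import structures.
From mathcomp Require Import all_boot all_order all_algebra.
From mathcomp Require Import all_classical all_reals.
From mathcomp Require Import generic_quotient topology.

Set Implicit Arguments.
Unset Strict Implicit.
Unset Printing Implicit Defensive.

Import Order.TTheory GRing.Theory Num.Theory numFieldTopology.Exports.
Local Open Scope classical_set_scope.
Local Open Scope ring_scope.
Local Open Scope quotient_scope.

Record category := Category {
  Ob : Type;
  Hom : Ob -> Ob -> Type;
  idm : forall x, Hom x x;
  comp : forall x y z, Hom y z -> Hom x y -> Hom x z;
  comp_idl : forall x y (f : Hom x y), comp (idm y) f = f;
  comp_idr : forall x y (f : Hom x y), comp f (idm x) = f;
  compA : forall x y z t (h : Hom z t) (g : Hom y z) (f : Hom x y),
    comp h (comp g f) = comp (comp h g) f }.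
Arguments idm {c} x.
Arguments comp {c x y z} g f.

(** The class of all morphisms.  Equality in [mor C] includes equality of
    sources and targets, so it is the equality needed for strict laws. *)
Record mor (C : category) := Mor { src : Ob C; tgt : Ob C; arr : Hom src tgt }.
Arguments Mor {C src tgt} arr.

(** [is_comp g f h] : the composite [g o f] is defined, i.e. the target of [f]
    is the source of [g], and it is equal to [h]. *)
Inductive is_comp (C : category) : mor C -> mor C -> mor C -> Prop :=
  IsComp x y z (g : Hom y z) (f : Hom x y) :
    is_comp (Mor g) (Mor f) (Mor (comp g f)).

Record strict_monoidal (C : category) := StrictMonoidal {
  unit_ob : Ob C;
  tens_ob : Ob C -> Ob C -> Ob C;
  tens_hom : forall x x' y y', Hom x x' -> Hom y y' ->
    Hom (tens_ob x y) (tens_ob x' y');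
  tens_id : forall x y, tens_hom (idm x) (idm y) = idm (tens_ob x y);
  tens_comp : forall x x' x'' y y' y'' (f' : Hom x' x'') (f : Hom x x')
      (g' : Hom y' y'') (g : Hom y y'),
    tens_hom (comp f' f) (comp g' g) = comp (tens_hom f' g') (tens_hom f g);
  tens_obA : forall x y z,
    tens_ob x (tens_ob y z) = tens_ob (tens_ob x y) z;
  tens_ob1l : forall x, tens_ob unit_ob x = x;
  tens_ob1r : forall x, tens_ob x unit_ob = x;
  tens_homA : forall x x' y y' z z'
      (f : Hom x x') (g : Hom y y') (h : Hom z z'),
    Mor (tens_hom f (tens_hom g h)) = Mor (tens_hom (tens_hom f g) h);
  tens_hom1l : forall x x' (f : Hom x x'),
    Mor (tens_hom (idm unit_ob) f) = Mor f;
  tens_hom1r : forall x x' (f : Hom x x'),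
    Mor (tens_hom f (idm unit_ob)) = Mor f }.
Arguments unit_ob {C} s.
Arguments tens_ob {C} s x y.
Arguments tens_hom {C} s {x x' y y'} f g.

Definition tens_mor (C : category) (S : strict_monoidal C) (f g : mor C) :
  mor C := Mor (tens_hom S (arr f) (arr g)).

Record functor (C D : category) := Functor {
  fob : Ob C -> Ob D;
  fhom : forall x y, Hom x y -> Hom (fob x) (fob y);
  fhom_id : forall x, fhom (idm x) = idm (fob x);
  fhom_comp : forall x y z (g : Hom y z) (f : Hom x y),
    fhom (comp g f) = comp (fhom g) (fhom f) }.
Arguments fob {C D} _ _.
Arguments fhom {C D} _ {x y} _.

Definition fmor (C D : category) (R : functor C D) (f : mor C) : mor D :=
  Mor (fhom R (arr f)).

Definition strict_monoidal_functor (C D : category) (SC : strict_monoidal C)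
    (SD : strict_monoidal D) (R : functor C D) : Prop :=
  [/\ fob R (unit_ob SC) = unit_ob SD,
      forall x y, fob R (tens_ob SC x y) = tens_ob SD (fob R x) (fob R y) &
      forall f g, fmor R (tens_mor SC f g) = tens_mor SD (fmor R f) (fmor R g)].

Section Vect.
Variable K : fieldType.

Definition vect_id (V : lmodType K) : {linear V -> V} := @idfun V.
Definition vect_comp (U V W : lmodType K) (g : {linear V -> W})
  (f : {linear U -> V}) : {linear U -> W} := g \o f.

Lemma linear_eq (U V : lmodType K) (f g : {linear U -> V}) : f =1 g -> f = g.
Proof.
case: f g => f [[f1] [f2]] [g [[g1] [g2]]] /= fg.
have {fg} E : f = g by apply/funext.
by subst g; rewrite (Prop_irrelevance f1 g1) (Prop_irrelevance f2 g2).
Qed.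

Lemma vect_comp_idl (U V : lmodType K) (f : {linear U -> V}) :
  vect_comp (vect_id V) f = f.
Proof. exact: linear_eq. Qed.

Lemma vect_comp_idr (U V : lmodType K) (f : {linear U -> V}) :
  vect_comp f (vect_id U) = f.
Proof. exact: linear_eq. Qed.

Lemma vect_compA (U V W X : lmodType K) (h : {linear W -> X})
    (g : {linear V -> W}) (f : {linear U -> V}) :
  vect_comp h (vect_comp g f) = vect_comp (vect_comp h g) f.
Proof. exact: linear_eq. Qed.

Definition Vect : category :=
  @Category (lmodType K) (fun V W => {linear V -> W}) vect_id vect_comp
    vect_comp_idl vect_comp_idr vect_compA.

(** The usual tensor product of [V] and [W]: formal sums of pairs, that is
    finite sequences of pairs up to order, modulo bilinearity. *)
Section Tensor.
Variables V W : lmodType K.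

Inductive tens_rel : seq (V * W) -> seq (V * W) -> Prop :=
| tens_refl s : tens_rel s s
| tens_sym s t : tens_rel s t -> tens_rel t s
| tens_trans s t u : tens_rel s t -> tens_rel t u -> tens_rel s u
| tens_cat s s' t t' :
    tens_rel s s' -> tens_rel t t' -> tens_rel (s ++ t) (s' ++ t')
| tens_comm s t : tens_rel (s ++ t) (t ++ s)
| tens_Dl v v' w : tens_rel [:: (v + v', w)] [:: (v, w); (v', w)]
| tens_Dr v w w' : tens_rel [:: (v, w + w')] [:: (v, w); (v, w')]
| tens_Z (a : K) v w : tens_rel [:: (a *: v, w)] [:: (v, a *: w)]
| tens_0 : tens_rel [:: (0, 0)] [::].

Definition tens_relb s t := `[< tens_rel s t >].

Lemma tens_relb_equiv : equiv_class_of tens_relb.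
Proof.
split=> [s|s t|t s u].
- exact/asboolP/tens_refl.
- by apply/asboolP/asboolP; exact: tens_sym.
- by move=> /asboolP st /asboolP tu; exact/asboolP/(tens_trans st).
Qed.

Canonical tens_equiv := EquivRelPack tens_relb_equiv.

Definition tensor := {eq_quot tens_relb}.
HB.instance Definition _ := Choice.on tensor.

Definition tens_class (s : seq (V * W)) : tensor := \pi_{eq_quot tens_relb} s.
Definition tens_repr (x : tensor) : seq (V * W) :=
  repr (x : {eq_quot tens_relb}).
Local Notation cl := tens_class.

Lemma tens_piP s t : tens_rel s t -> cl s = cl t.
Proof. by move=> st; apply/eqquotP/asboolP. Qed.

Lemma tensW (P : tensor -> Prop) : (forall s, P (cl s)) -> forall x, P x.
Proof. by move=> Pcl; elim/quotW. Qed.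

Lemma tens_reprP s : tens_rel (tens_repr (cl s)) s.
Proof.
apply/asboolP; rewrite -[`[< _ >]]/(tens_relb _ _).
by apply/(@eqquotP _ _ {eq_quot tens_relb}); rewrite reprK.
Qed.

Definition tens_scale (a : K) (s : seq (V * W)) :=
  [seq (a *: p.1, p.2) | p <- s].

Lemma tens_scale_rel a s t :
  tens_rel s t -> tens_rel (tens_scale a s) (tens_scale a t).
Proof.
elim=> {s t} [s|s t _|s t u _ h1 _ h2|s s' t t' _ h1 _ h2|s t|v v' w|v w w'
  |b v w|] /=.
- exact: tens_refl.
- exact: tens_sym.
- exact: tens_trans h2.
- by rewrite /tens_scale !map_cat; exact: tens_cat.
- by rewrite /tens_scale !map_cat; exact: tens_comm.
- by rewrite scalerDr; exact: tens_Dl.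
- exact: tens_Dr.
- by rewrite scalerA mulrC -scalerA; exact: tens_Z.
- by rewrite scaler0; exact: tens_0.
Qed.

Definition tens_zero : tensor := cl [::].
Definition tens_add (x y : tensor) : tensor := cl (tens_repr x ++ tens_repr y).
Definition tens_mulz (a : K) (x : tensor) : tensor := cl (tens_scale a (tens_repr x)).
Definition tens_opp (x : tensor) : tensor := tens_mulz (-1) x.

Lemma tens_add_pi s t : tens_add (cl s) (cl t) = cl (s ++ t).
Proof. by apply/tens_piP/tens_cat; exact: tens_reprP. Qed.

Lemma tens_mulz_pi a s : tens_mulz a (cl s) = cl (tens_scale a s).
Proof. by apply/tens_piP/tens_scale_rel/tens_reprP. Qed.

Lemma tens_addA : associative tens_add.
Proof.
by move=> p q r; elim/tensW: p => x; elim/tensW: q => y; elim/tensW: r => z; rewrite !tens_add_pi catA.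
Qed.

Lemma tens_addC : commutative tens_add.
Proof.
by move=> p q; elim/tensW: p => x; elim/tensW: q => y; rewrite !tens_add_pi; exact/tens_piP/tens_comm.
Qed.

Lemma tens_add0 : left_id tens_zero tens_add.
Proof. by move=> p; elim/tensW: p => x; rewrite /tens_zero tens_add_pi. Qed.

Lemma tens_scale0 s : tens_rel (tens_scale 0 s) [::].
Proof.
elim: s => [|[v w] s IH] /=; first exact: tens_refl.
rewrite -cat1s -[[::]]cats0; apply: tens_cat => //.
rewrite scale0r -(scale0r 0); apply: tens_trans (tens_Z _ _ _) _.
by rewrite scale0r; exact: tens_0.
Qed.

Lemma tens_scaleD a b s :
  tens_rel (tens_scale (a + b) s) (tens_scale a s ++ tens_scale b s).
Proof.
elim: s => [|[v w] s IH] /=; first exact: tens_refl.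
rewrite scalerDl -cat1s.
apply: tens_trans (tens_cat (tens_Dl _ _ _) IH) _.
change (tens_rel
  (([:: (a *: v, w)] ++ [:: (b *: v, w)]) ++ tens_scale a s ++ tens_scale b s)
  (([:: (a *: v, w)] ++ tens_scale a s) ++ [:: (b *: v, w)] ++ tens_scale b s)).
rewrite -!catA.
apply: tens_cat; first exact: tens_refl.
rewrite !catA; apply: tens_cat; last exact: tens_refl.
exact: tens_comm.
Qed.

Lemma tens_addN : left_inverse tens_zero tens_opp tens_add.
Proof.
move=> p; elim/tensW: p => x; rewrite /tens_opp /tens_zero tens_mulz_pi tens_add_pi.
apply: tens_piP; apply: tens_trans (tens_scale0 x).
rewrite -(addNr 1); apply: tens_trans (tens_sym (tens_scaleD _ _ _)).
rewrite [tens_scale 1 x](_ : _ = x); first exact: tens_refl.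
by rewrite /tens_scale -[RHS]map_id; apply: eq_map => -[v w] /=; rewrite scale1r.
Qed.

HB.instance Definition _ :=
  GRing.isZmodule.Build tensor tens_addA tens_addC tens_add0 tens_addN.

Lemma tens_mulzA a b x : tens_mulz a (tens_mulz b x) = tens_mulz (a * b) x.
Proof.
elim/tensW: x => x; rewrite !tens_mulz_pi; congr (cl _).
by rewrite /tens_scale -map_comp; apply: eq_map => -[v w] /=; rewrite scalerA.
Qed.

Lemma tens_mulz1 : left_id 1 tens_mulz.
Proof.
move=> p; elim/tensW: p => x; rewrite tens_mulz_pi; congr (cl _).
by rewrite /tens_scale -[RHS]map_id; apply: eq_map => -[v w] /=; rewrite scale1r.
Qed.

Lemma tens_mulzDr : right_distributive tens_mulz +%R.
Proof.
move=> a; move=> p q; elim/tensW: p => x; elim/tensW: q => y.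
by rewrite /GRing.add /= !(tens_mulz_pi, tens_add_pi) /tens_scale map_cat.
Qed.

Lemma tens_mulzDl x : {morph tens_mulz^~ x : a b / a + b}.
Proof.
move=> a b; elim/tensW: x => x; rewrite [in RHS]/GRing.add /= !tens_mulz_pi.
by rewrite tens_add_pi; apply/tens_piP/tens_scaleD.
Qed.

HB.instance Definition _ := GRing.Zmodule_isLmodule.Build K tensor
  tens_mulzA tens_mulz1 tens_mulzDr tens_mulzDl.

Definition ptens (v : V) (w : W) : tensor := cl [:: (v, w)].

End Tensor.
End Vect.

(** A vector together with the space it lives in.  Equality of such pairs
    compares vectors of spaces which are equal but not convertible. *)
Definition vec (K : fieldType) (V : lmodType K) (v : V) :
  {V : lmodType K & V} := existT (fun V : lmodType K => V : Type) V v.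

(** A strict monoidal structure on [Vect K], with unit the ground field,
    together with an isomorphism [st_iso] from the usual tensor product making
    the identity functor a monoidal equivalence.  Since [ptens v w] span the
    usual tensor product, naturality and compatibility with the associators
    and unitors are expressed on them: the usual associator maps
    [u (x) (v (x) w)] to [(u (x) v) (x) w], and the usual unitors map
    [a (x) v] and [v (x) a] to [a *: v]. *)
Record strict_tensor (K : fieldType) := StrictTensor {
  st_monoidal :> strict_monoidal (Vect K);
  st_ob := (fun V W : lmodType K => tens_ob st_monoidal V W : lmodType K);
  st_hom := (fun (V V' W W' : lmodType K) (f : {linear V -> V'})
      (g : {linear W -> W'}) =>
    @tens_hom (Vect K) st_monoidal V V' W W' f g
      : {linear st_ob V W -> st_ob V' W'});
  st_unit : unit_ob st_monoidal = (K^o : lmodType K);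
  st_iso : forall V W : lmodType K, {linear tensor V W -> st_ob V W};
  st_iso_bij : forall V W : lmodType K, bijective (@st_iso V W);
  st_iso_nat : forall (V V' W W' : lmodType K) (f : {linear V -> V'})
      (g : {linear W -> W'}) (v : V) (w : W),
    st_hom f g (st_iso V W (ptens v w)) = st_iso V' W' (ptens (f v) (g w));
  st_iso_assoc : forall (U V W : lmodType K) (u : U) (v : V) (w : W),
    vec (st_iso U (st_ob V W) (ptens u (st_iso V W (ptens v w)))) =
    vec (st_iso (st_ob U V) W (ptens (st_iso U V (ptens u v)) w));
  st_iso_unitl : forall (V : lmodType K) (a : K) (v : V),
    vec (st_iso (K^o : lmodType K) V (ptens (a : K^o) v)) = vec (a *: v);
  st_iso_unitr : forall (V : lmodType K) (v : V) (a : K),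
    vec (st_iso V (K^o : lmodType K) (ptens v (a : K^o))) = vec (a *: v) }.

Section Homeomorphisms.
Context {X Y : topologicalType}.

Definition is_homeo (f : X -> Y) :=
  continuous f /\ exists g : Y -> X, [/\ continuous g, cancel f g & cancel g f].

End Homeomorphisms.

(** For [A : set X], the type [A] carries the subspace topology. *)
Record homeo (X Y : topologicalType) (A : set X) (B : set Y) := Homeo {
  homeo_fun :> A -> B;
  homeoP : is_homeo homeo_fun }.

Section Charts.
Context {X E : topologicalType}.

(** [x] has an open neighbourhood in the space [A] which is homeomorphic to an
    open subset of the space [H]. *)
Definition has_chart (A : set X) (H : set E) (x : X) :=
  exists (U : set X) (V : set E), [/\ open U, U x, open V &
    exists f : (A `&` U) -> (H `&` V), is_homeo f].

End Charts.

Section Manifolds.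
Variables (R : realType) (n : nat).

Definition half_space : set 'rV[R]_n.+1 := [set v | 0 <= v ord0 ord0].

(** Second countability is automatic for compact locally Euclidean spaces. *)
Definition is_closed_manifold (X : topologicalType) (M : set X) :=
  [/\ compact M, hausdorff_space M &
      forall x, M x -> has_chart M [set: 'rV[R]_n] x].

Definition is_compact_bmanifold (X : topologicalType) (W : set X) :=
  [/\ compact W, hausdorff_space W &
      forall x, W x -> has_chart W half_space x].

Definition boundary (X : topologicalType) (W : set X) : set X :=
  [set x | W x /\ ~ has_chart W [set: 'rV[R]_n.+1] x].

(** Closed [n]-manifolds, as subspaces of the ambient space [X]. *)
Record cmanifold (X : topologicalType) := CManifold {
  mpts :> set X;
  mptsP : is_closed_manifold mpts }.

(** Bordisms [(W, M, N)], as subspaces of the ambient space [X], with [M = bin] and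
    [N = bout]. *)
Record bordism (X : topologicalType) := Bordism {
  bpts :> set X;
  bin : cmanifold X;
  bout : cmanifold X;
  bptsP : is_compact_bmanifold bpts;
  b_disj : bin `&` bout = set0;
  b_boundary : boundary bpts = bin `|` bout }.

Definition subbordism (X : topologicalType) (W0 W : bordism X) :=
  [/\ W0 `<=` W,
      forall x, mpts (bin W0) x ->
        let C := connected_component (bin W0) x in
        C `&` boundary W = set0 \/ C `<=` bin W &
      forall x, mpts (bout W0) x ->
        let C := connected_component (bout W0) x in
        C `&` boundary W = set0 \/ C `<=` bout W].

Definition is_bhomeo (X Y : topologicalType) (W : bordism X) (W' : bordism Y)
    (phi : homeo W W') :=
  (forall x : W, mpts (bin W) (val x) <-> mpts (bin W') (val (phi x))) /\
  (forall x : W, mpts (bout W) (val x) <-> mpts (bout W') (val (phi x))).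

Record bhomeo (X Y : topologicalType) (W : bordism X) (W' : bordism Y) :=
  BHomeo {
    bhomeo_homeo :> homeo W W';
    bhomeoP : is_bhomeo bhomeo_homeo }.

(** [W] is the result [W' U_N W''] of gluing its subbordisms [W'] from [M] to
    [N] and [W''] from [N] to [P].  As [W'] and [W''] are compact and [W] is
    Hausdorff, [W] has the gluing topology. *)
Definition is_gluing (X : topologicalType) (N : cmanifold X)
    (W W' W'' : bordism X) :=
  [/\ bpts W = W' `|` W'', W' `&` W'' = N,
      bout W' = N /\ bin W'' = N & bin W = bin W' /\ bout W = bout W''].

End Manifolds.

Section HomeoTheory.

Lemma set0_absurd (T : Type) (A : set T) (z : T) : A = set0 -> A z -> False.
Proof. by move=> ->. Qed.

Lemma continuousT_comp (X Y Z : topologicalType) (f : X -> Y) (g : Y -> Z) :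
  continuous f -> continuous g -> continuous (g \o f).
Proof. by move=> cf cg x; apply: continuous_comp; [exact: cf|exact: cg]. Qed.

Lemma sub_openP (X : topologicalType) (A : set X) (U : set A) :
  open U <-> exists2 O, open O & val @^-1` O = U.
Proof. by split=> -[O oO OU]; exists O. Qed.

Lemma sub_continuous (X Y : topologicalType) (A : set X) (f : Y -> A) :
  continuous (val \o f : Y -> X) -> continuous f.
Proof.
move=> /continuousP cf; apply/continuousP => U /sub_openP[O oO <-].
exact: cf.
Qed.

Lemma val_continuous (X : topologicalType) (A : set X) :
  continuous (val : A -> X).
Proof. by apply/continuousP => O oO; apply/sub_openP; exists O. Qed.

Lemma is_homeo_comp (X Y Z : topologicalType) (f : X -> Y) (g : Y -> Z) :
  is_homeo f -> is_homeo g -> is_homeo (g \o f).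
Proof.
move=> [cf [f' [cf' fK f'K]]] [cg [g' [cg' gK g'K]]]; split.
  exact: continuousT_comp.
exists (f' \o g'); split; [|exact: can_comp|exact: can_comp].
exact: continuousT_comp.
Qed.

Lemma is_homeo_inv (X Y : topologicalType) (f : X -> Y) :
  is_homeo f -> exists g : Y -> X, is_homeo g /\ cancel f g.
Proof.
by move=> [cf [g [cg fK gK]]]; exists g; split=> //; split=> //; exists f.
Qed.

(** Restriction of a homeomorphism to a subset and its image. *)
Lemma is_homeo_restr (X Y : topologicalType) (A A0 : set X) (B B0 : set Y)
    (f : A -> B) : A0 `<=` A -> B0 `<=` B -> is_homeo f ->
    (forall x : A, A0 (val x) <-> B0 (val (f x))) ->
  exists f0 : A0 -> B0, is_homeo f0.
Proof.
move=> sA sB [cf [g [cg fK gK]]] fP.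
have sA' (x : A0) : val x \in A by apply/mem_set/sA/set_mem/(valP x).
have sB' (y : B0) : val y \in B by apply/mem_set/sB/set_mem/(valP y).
pose iA (x : A0) : A := exist _ (val x) (sA' x).
pose iB (y : B0) : B := exist _ (val y) (sB' y).
have ciA : continuous iA by apply: sub_continuous; exact: val_continuous.
have ciB : continuous iB by apply: sub_continuous; exact: val_continuous.
have hf (x : A0) : val (f (iA x)) \in B0.
  by apply/mem_set/fP/set_mem/(valP x).
have hg (y : B0) : val (g (iB y)) \in A0.
  by apply/mem_set/fP; rewrite gK; apply/set_mem/(valP y).
pose f0 (x : A0) : B0 := exist _ (val (f (iA x))) (hf x).
pose g0 (y : B0) : A0 := exist _ (val (g (iB y))) (hg y).
exists f0; split.
  apply: sub_continuous; apply: (continuousT_comp (f := f \o iA)).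
    exact: continuousT_comp.
  exact: val_continuous.
exists g0; split.
- apply: sub_continuous; apply: (continuousT_comp (f := g \o iB)).
    exact: continuousT_comp.
  exact: val_continuous.
- move=> x; apply/val_inj => /=.
  by rewrite (_ : iB _ = f (iA x)) ?fK//; exact: val_inj.
- move=> y; apply/val_inj => /=.
  by rewrite (_ : iA _ = g (iB y)) ?gK//; apply: val_inj.
Qed.

Lemma is_homeo_eq (X : topologicalType) (A B : set X) : A = B ->
  exists f : A -> B, is_homeo f.
Proof.
by move=> <-; exists id; split; [|exists id; split] => // x; exact: cvg_id.
Qed.

Definition open_embedding (X Z : topologicalType) (i : X -> Z) :=
  [/\ continuous i, injective i & forall O, open O -> open (i @` O)].

Section Embedding.
Variables (X Z : topologicalType) (i : X -> Z).

Definition embed_fun (A : set X) (x : A) : i @` A :=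
  exist _ (i (val x)) (mem_set (imageP i (set_mem (valP x)))).

Lemma embed_homeo (A : set X) : open_embedding i -> is_homeo (@embed_fun A).
Proof.
move=> [ci inji opi]; split.
  apply: sub_continuous; apply: (continuousT_comp (f := (val : A -> X)) (g := i)) => //.
  exact: val_continuous.
have inv (z : i @` A) : {x : A | i (val x) = val z}.
  have /cid2[x Ax xz] := set_mem (valP z).
  by exists (exist _ x (mem_set Ax)).
pose g (z : i @` A) : A := sval (inv z); have gP z : i (val (g z)) = val z := svalP (inv z).
exists g; split.
- apply/continuousP => U oU; have [O oO <-] := (sub_openP U).1 oU.
  apply/sub_openP; exists (i @` O); first exact: opi.
  apply/seteqP; split=> z /=; last by exists (val (g z)).
  by case=> x Ox xz; rewrite -(inji x (val (g z))) // gP.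
- by move=> x; apply/val_inj/inji; rewrite gP.
- by move=> z; apply/val_inj => /=; rewrite gP.
Qed.

End Embedding.

Section ChartTheory.
Variable E : topologicalType.

Lemma chart_image (X Z : topologicalType) (i : X -> Z) (H : set E)
    (A : set X) (x : X) : open_embedding i ->
  has_chart A H x <-> has_chart (i @` A) H (i x).
Proof.
move=> oi; have [ci inji opi] := oi; split.
- move=> [U [V [oU Ux oV [f hf]]]]; exists (i @` U), V; split => //; first exact: opi.
  have [e he] : exists f : (i @` A `&` i @` U) -> (A `&` U), is_homeo f.
    have -> : i @` A `&` i @` U = i @` (A `&` U).
      apply/seteqP; split=> [z [[a Aa <-] [u Uu /inji ua]]|z [a [Aa Ua] <-]].
        by exists a => //; split=> //; rewrite -ua.
      by split; exists a.
    by have [g [hg _]] := is_homeo_inv (embed_homeo (A `&` U) oi); exists g.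
  by exists (f \o e); exact: is_homeo_comp.
- move=> [U [V [oU Ux oV [f hf]]]]; exists (i @^-1` U), V; split => //.
    by apply: open_comp => // y _; exact: ci.
  have [e he] : exists f : (A `&` i @^-1` U) -> (i @` A `&` U), is_homeo f.
    have -> : i @` A `&` U = i @` (A `&` i @^-1` U).
      apply/seteqP; split=> [z [[a Aa <-] Ua]|z [a [Aa Ua] <-]]; first by exists a.
      by split => //; exists a.
    by exists (@embed_fun _ _ i (A `&` i @^-1` U)); exact: embed_homeo.
  by exists (f \o e); exact: is_homeo_comp.
Qed.

Lemma chart_local (X : topologicalType) (H : set E) (A B O : set X) (x : X) :
  open O -> O x -> A `&` O = B `&` O -> has_chart A H x -> has_chart B H x.
Proof.
move=> oO Ox AB [U [V [oU Ux oV [f hf]]]].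
have [cf [g [cg fK gK]]] := hf.
pose S : set (H `&` V) := g @^-1` (val @^-1` O).
have [V0 oV0 V0S] : exists2 V0, open V0 & val @^-1` V0 = S.
  apply/sub_openP; move/continuousP: cg; apply.
  by apply/sub_openP; exists O.
exists (U `&` O), (V `&` V0); split=> //; [exact: openI|exact: openI|].
have -> : B `&` (U `&` O) = A `&` (U `&` O).
  by rewrite ![_ `&` (U `&` O)]setIA ![_ `&` U]setIC -!setIA AB.
apply: (is_homeo_restr _ _ hf) => [y [Ay [Uy _]]//|y [Hy [Vy _]]//|y].
have /set_mem[Ay Uy] := valP y; have /set_mem[Hy Vy] := valP (f y).
have -> : (H `&` (V `&` V0)) (val (f y)) <-> S (f y).
  by rewrite -V0S; split=> [[_ []]|?].
by rewrite /S /= fK; split=> [[_ []]|?].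
Qed.

End ChartTheory.

Lemma hausdorff_setP (X : topologicalType) (A : set X) :
  hausdorff_space A <->
  (forall x y, A x -> A y -> x <> y -> exists U V : set X,
    [/\ open U, open V, U x, V y & A `&` (U `&` V) = set0]).
Proof.
rewrite open_hausdorff; split=> [hA x y Ax Ay xy|hA x y xy].
  have /hA[[U V] /= [xU yV]] :
      (exist _ x (mem_set Ax) : A) != exist _ y (mem_set Ay).
    by apply/eqP => -[].
  move=> [/sub_openP[U0 oU0 UE] /sub_openP[V0 oV0 VE] UV].
  exists U0, V0; split=> //.
  - by move: xU; rewrite inE -UE.
  - by move: yV; rewrite inE -VE.
  apply/seteqP; split=> // z [Az [U0z V0z]].
  have : (U `&` V) (exist _ z (mem_set Az)) by rewrite -UE -VE.
  by rewrite (eqP UV).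
have [||/(contra_not (@val_inj _ _ _ x y))|U [V [oU oV Ux Vy UV]]] :=
  hA (val x) (val y).
- exact/set_mem/(valP x).
- exact/set_mem/(valP y).
- by apply; apply/eqP.
exists (val @^-1` U, val @^-1` V) => /=; first by rewrite !inE.
split; [by apply/sub_openP; exists U|by apply/sub_openP; exists V|].
apply/eqP/seteqP; split=> // z [Uz Vz].
by apply: (set0_absurd UV (z := val z)); split => //; exact/set_mem/(valP z).
Qed.

Lemma hausdorff_image (X Z : topologicalType) (i : X -> Z) (A : set X) :
  open_embedding i -> hausdorff_space A -> hausdorff_space (i @` A).
Proof.
move=> [ci inji opi] /hausdorff_setP hA; apply/hausdorff_setP.
move=> _ _ [x Ax <-] [y Ay <-] xy.
have [U [V [oU oV Ux Vy UV]]] : exists U V : set X,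
    [/\ open U, open V, U x, V y & A `&` (U `&` V) = set0].
  by apply: hA => // xE; apply: xy; rewrite xE.
exists (i @` U), (i @` V); split; [exact: opi|exact: opi|by exists x|by exists y|].
apply/seteqP; split=> // _ [[a Aa <-] [[u Uu /inji ua] [v Vv /inji va]]].
by apply: (set0_absurd UV (z := a)); split=> //; move: Uu Vv; rewrite ua va.
Qed.

Lemma hausdorff_union (Z : topologicalType) (A B OA OB : set Z) :
  open OA -> open OB -> OA `&` OB = set0 -> A `<=` OA -> B `<=` OB ->
  hausdorff_space A -> hausdorff_space B -> hausdorff_space (A `|` B).
Proof.
move=> oA oB dAB sA sB /hausdorff_setP hA /hausdorff_setP hB.
have d z : OA z -> OB z -> False by move=> Az Bz; apply: (set0_absurd dAB (z := z)); split.
apply/hausdorff_setP => x y [Ax|Bx] [Ay|By] xy.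
- have [U [V [oU oV Ux Vy UV]]] := hA _ _ Ax Ay xy.
  exists (U `&` OA), (V `&` OA); split; [exact: openI|exact: openI| | |].
  + by split=> //; exact: sA.
  + by split=> //; exact: sA.
  apply/seteqP; split=> // z [[Az|/sB Bz] [[Uz Oz] [Vz _]]]; last exact: d Bz.
  by apply: (set0_absurd UV (z := z)); split.
- by exists OA, OB; split; auto; apply/seteqP; split=> // z [_ []]; exact: d.
- by exists OB, OA; split; auto; apply/seteqP; split=> // z [_ []] /[swap]; exact: d.
- have [U [V [oU oV Ux Vy UV]]] := hB _ _ Bx By xy.
  exists (U `&` OB), (V `&` OB); split; [exact: openI|exact: openI| | |].
  + by split=> //; exact: sB.
  + by split=> //; exact: sB.
  apply/seteqP; split=> // z [[/sA Az|Bz] [[Uz Oz] [Vz _]]].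
    by have := d _ Az Oz.
  by apply: (set0_absurd UV (z := z)); split.
Qed.

End HomeoTheory.


(** The ordered topological disjoint union of two spaces. *)
Definition dsum (X Y : topologicalType) : topologicalType :=
  {b : bool & (if b then Y else X : topologicalType)}.
Definition dinl (X Y : topologicalType) (x : X) : dsum X Y := existT _ false x.
Definition dinr (X Y : topologicalType) (y : Y) : dsum X Y := existT _ true y.

Lemma existT_open_embedding (I : choiceType) (F : I -> topologicalType) (i : I) :
  open_embedding (existT F i).
Proof.
split; [exact: existT_continuous| |exact: existT_open_map].
by move=> x y; apply: eq_from_Tagged.
Qed.

Lemma dinl_open (X Y : topologicalType) : open_embedding (@dinl X Y).
Proof. exact: (@existT_open_embedding _ _ false). Qed.

Lemma dinr_open (X Y : topologicalType) : open_embedding (@dinr X Y).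
Proof. exact: (@existT_open_embedding _ _ true). Qed.

Lemma dinlr_disj (X Y : topologicalType) :
  range (@dinl X Y) `&` range (@dinr X Y) = set0.
Proof. by apply/seteqP; split=> // z [[x _ <-] [y _]]. Qed.

Section ManifoldTheory.
Variables (R : realType) (n : nat).

Lemma closed_manifold_image (X Z : topologicalType) (i : X -> Z) (M : set X) :
  open_embedding i -> is_closed_manifold R n M ->
  is_closed_manifold R n (i @` M).
Proof.
move=> oi [cM hM eM]; have [ci _ _] := oi; split.
- by apply: continuous_compact => //; exact: continuous_subspaceT.
- exact: hausdorff_image.
- by move=> _ [x Mx <-]; apply/(chart_image _ _ _ oi); exact: eM.
Qed.

Lemma bmanifold_image (X Z : topologicalType) (i : X -> Z) (W : set X) :
  open_embedding i -> is_compact_bmanifold R n W ->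
  is_compact_bmanifold R n (i @` W).
Proof.
move=> oi [cM hM eM]; have [ci _ _] := oi; split.
- by apply: continuous_compact => //; exact: continuous_subspaceT.
- exact: hausdorff_image.
- by move=> _ [x Mx <-]; apply/(chart_image _ _ _ oi); exact: eM.
Qed.

Lemma boundary_image (X Z : topologicalType) (i : X -> Z) (W : set X) :
  open_embedding i -> boundary R n (i @` W) = i @` boundary R n W.
Proof.
move=> oi; apply/seteqP; split=> [z [[x Wx <-] Nx]|z [x [Wx Nx] <-]].
  by exists x => //; split=> // cx; apply: Nx; apply/(chart_image _ _ _ oi).
by split; [exists x|move=> /(chart_image _ _ _ oi)].
Qed.

Section Union.
Variables (Z : topologicalType) (OA OB A B : set Z).
Hypotheses (oA : open OA) (oB : open OB) (dAB : OA `&` OB = set0).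
Hypotheses (sA : A `<=` OA) (sB : B `<=` OB).

Let unionA : A `&` OA = (A `|` B) `&` OA.
Proof.
apply/seteqP; split=> z [Az Oz]; split=> //; first by left.
by case: Az => // /sB Bz; have := set0_absurd dAB (conj Oz Bz).
Qed.

Let unionB : B `&` OB = (A `|` B) `&` OB.
Proof.
apply/seteqP; split=> z [Az Oz]; split=> //; first by right.
by case: Az => // /sA Bz; have := set0_absurd dAB (conj Bz Oz).
Qed.

Lemma closed_manifold_union : is_closed_manifold R n A ->
  is_closed_manifold R n B -> is_closed_manifold R n (A `|` B).
Proof.
move=> [cA hA eA] [cB hB eB]; split; first exact: compactU.
  exact: (hausdorff_union oA oB).
move=> z [Az|Bz].
  by apply: (chart_local oA _ unionA) => //; [exact: sA|exact: eA].
by apply: (chart_local oB _ unionB) => //; [exact: sB|exact: eB].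
Qed.

Lemma bmanifold_union : is_compact_bmanifold R n A ->
  is_compact_bmanifold R n B -> is_compact_bmanifold R n (A `|` B).
Proof.
move=> [cA hA eA] [cB hB eB]; split; first exact: compactU.
  exact: (hausdorff_union oA oB).
move=> z [Az|Bz].
  by apply: (chart_local oA _ unionA) => //; [exact: sA|exact: eA].
by apply: (chart_local oB _ unionB) => //; [exact: sB|exact: eB].
Qed.

Lemma boundary_union :
  boundary R n (A `|` B) = boundary R n A `|` boundary R n B.
Proof.
apply/seteqP; split=> z.
  case=> [[Az|Bz] Nz]; [left|right]; split=> // cz; apply: Nz.
    by apply: (chart_local oA _ unionA) => //; exact: sA.
  by apply: (chart_local oB _ unionB) => //; exact: sB.
case=> -[Az Nz]; split; [by left| |by right|] => cz; apply: Nz.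
  by apply: (chart_local oA _ (esym unionA)) => //; exact: sA.
by apply: (chart_local oB _ (esym unionB)) => //; exact: sB.
Qed.

End Union.

Section Image.
Variables (X Z : topologicalType) (i : X -> Z) (oi : open_embedding i).

Definition cm_image (M : cmanifold R n X) : cmanifold R n Z :=
  CManifold (closed_manifold_image oi (mptsP M)).

Variable W : bordism R n X.

Lemma b_image_disj : cm_image (bin W) `&` cm_image (bout W) = set0.
Proof.
have [_ inji _] := oi; apply/seteqP; split=> // z [[x Mx <-] [y Ny /inji yx]].
by apply: (set0_absurd (b_disj W) (z := x)); split=> //; rewrite -yx.
Qed.

Lemma b_image_boundary :
  boundary R n (i @` W) = cm_image (bin W) `|` cm_image (bout W).
Proof. by rewrite boundary_image// b_boundary image_setU. Qed.

Definition b_image : bordism R n Z :=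
  Bordism (bmanifold_image oi (bptsP W)) b_image_disj b_image_boundary.

(** [W] is homeomorphic to its image under an open embedding. *)
Definition image_homeo (A : set X) : homeo A (i @` A) :=
  Homeo (@embed_homeo _ _ i A oi).

Lemma image_is_bhomeo : is_bhomeo (W' := b_image) (image_homeo W).
Proof.
have [_ inji _] := oi.
by split=> x; split=> [Mx|[y My /inji <-]//]; exists (val x).
Qed.

Definition image_bhomeo : bhomeo W b_image := BHomeo image_is_bhomeo.

End Image.

Section Sum.
Variables (X Y : topologicalType).

Lemma dinl_range (A : set X) : @dinl X Y @` A `<=` range (@dinl X Y).
Proof. by move=> _ [x _ <-]; exists x. Qed.

Lemma dinr_range (A : set Y) : @dinr X Y @` A `<=` range (@dinr X Y).
Proof. by move=> _ [x _ <-]; exists x. Qed.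

Lemma dinl_range_open : open (range (@dinl X Y)).
Proof. by have [_ _ o] := dinl_open X Y; apply: o; exact: openT. Qed.

Lemma dinr_range_open : open (range (@dinr X Y)).
Proof. by have [_ _ o] := dinr_open X Y; apply: o; exact: openT. Qed.

Section CSum.
Variables (M : cmanifold R n X) (N : cmanifold R n Y).

Definition cm_inl : cmanifold R n (dsum X Y) := cm_image (dinl_open X Y) M.
Definition cm_inr : cmanifold R n (dsum X Y) := cm_image (dinr_open X Y) N.

Definition cm_sum : cmanifold R n (dsum X Y) :=
  CManifold (closed_manifold_union dinl_range_open dinr_range_open
    (@dinlr_disj X Y) (@dinl_range M) (@dinr_range N) (mptsP cm_inl)
    (mptsP cm_inr)).

Lemma cm_inl_sub : cm_inl `<=` cm_sum. Proof. by left. Qed.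
Lemma cm_inr_sub : cm_inr `<=` cm_sum. Proof. by right. Qed.

End CSum.

Section BSum.
Variables (W : bordism R n X) (W' : bordism R n Y).

Definition b_inl : bordism R n (dsum X Y) := b_image (dinl_open X Y) W.
Definition b_inr : bordism R n (dsum X Y) := b_image (dinr_open X Y) W'.

Lemma b_sum_disj :
  cm_sum (bin W) (bin W') `&` cm_sum (bout W) (bout W') = set0.
Proof.
have [_ injl _] := dinl_open X Y; have [_ injr _] := dinr_open X Y.
apply/seteqP; split=> // z [[[x Mx <-]|[y My <-]] [[x' Nx']|[y' Ny']]] //.
  move=> /injl xx; apply: (set0_absurd (b_disj W) (z := x)).
  by split=> //; rewrite -xx.
move=> /injr yy; apply: (set0_absurd (b_disj W') (z := y)).
by split=> //; rewrite -yy.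
Qed.

Lemma b_sum_boundary : boundary R n (b_inl `|` b_inr) =
  cm_sum (bin W) (bin W') `|` cm_sum (bout W) (bout W').
Proof.
rewrite (boundary_union dinl_range_open dinr_range_open (@dinlr_disj X Y)
  (@dinl_range W) (@dinr_range W')).
by rewrite (b_boundary b_inl) (b_boundary b_inr) setUACA.
Qed.

Definition b_sum : bordism R n (dsum X Y) :=
  Bordism (bmanifold_union dinl_range_open dinr_range_open
    (@dinlr_disj X Y) (@dinl_range W) (@dinr_range W') (bptsP b_inl)
    (bptsP b_inr)) b_sum_disj b_sum_boundary.

Lemma b_inl_sub : subbordism b_inl b_sum.
Proof.
by split=> [z|x _|x _]; [left|right|right] => // z /connected_component_sub; left.
Qed.

Lemma b_inr_sub : subbordism b_inr b_sum.
Proof.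
by split=> [z|x _|x _]; [right|right|right] => // z /connected_component_sub; right.
Qed.

End BSum.
End Sum.

Section Gluing.
Variables (X : topologicalType) (N : cmanifold R n X) (W W' W'' : bordism R n X).
Hypothesis g : is_gluing N W W' W''.

Lemma gluing_subl : subbordism W' W.
Proof.
case: g => WE NE [oN iN] [iW oW]; split=> [x W'x|x _ C|x _ C].
- by rewrite WE; left.
- by right; rewrite iW; exact: connected_component_sub.
- left; apply/seteqP; split=> // z [/connected_component_sub Nz].
  rewrite b_boundary iW oW => -[Mz|Pz].
    exact: (set0_absurd (b_disj W') (conj Mz Nz)).
  by rewrite oN -iN in Nz; exact: (set0_absurd (b_disj W'') (conj Nz Pz)).
Qed.

Lemma gluing_subr : subbordism W'' W.
Proof.
case: g => WE NE [oN iN] [iW oW]; split=> [x W''x|x _ C|x _ C].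
- by rewrite WE; right.
- left; apply/seteqP; split=> // z [/connected_component_sub Nz].
  rewrite b_boundary iW oW => -[Mz|Pz].
    by rewrite iN -oN in Nz; exact: (set0_absurd (b_disj W') (conj Mz Nz)).
  exact: (set0_absurd (b_disj W'') (conj Nz Pz)).
- by right; rewrite oW; exact: connected_component_sub.
Qed.

Lemma gluing_midl : N `<=` W'.
Proof. by case: g => _ <- _ _ z []. Qed.

Lemma gluing_midr : N `<=` W''.
Proof. by case: g => _ <- _ _ z []. Qed.

End Gluing.
End ManifoldTheory.

(** Fields are assigned to manifolds given as subsets of arbitrary ambient
    spaces, so that restricting to submanifolds in stages makes sense on the
    nose; the ambient space can be changed along homeomorphisms.  "The" empty
    manifold is any manifold whose set of points is empty.  Restriction maps
    take as argument a proof that they are defined. *)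
Record field_system (R : realType) (n : nat) := FieldSystem {
  fldB : forall X : topologicalType, bordism R n X -> Type;
  fldM : forall X : topologicalType, cmanifold R n X -> Type;
  fldB_empty : forall (X : topologicalType) (W : bordism R n X),
    bpts W = set0 -> exists p : fldB W, forall q, q = p;
  fldM_empty : forall (X : topologicalType) (M : cmanifold R n X),
    mpts M = set0 -> exists p : fldM M, forall q, q = p;

  resB : forall (X : topologicalType) (W W0 : bordism R n X),
    subbordism W0 W -> fldB W -> fldB W0;
  resM : forall (X : topologicalType) (M M0 : cmanifold R n X),
    M0 `<=` M -> fldM M -> fldM M0;
  resBM : forall (X : topologicalType) (W : bordism R n X)
    (M : cmanifold R n X), M `<=` W -> fldB W -> fldM M;
  resBB : forall (X : topologicalType) (W W0 W1 : bordism R n X)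
      (h0 : subbordism W0 W) (h1 : subbordism W1 W0) (h : subbordism W1 W) f,
    resB h1 (resB h0 f) = resB h f;
  resMM : forall (X : topologicalType) (M M0 M1 : cmanifold R n X)
      (h0 : M0 `<=` M) (h1 : M1 `<=` M0) (h : M1 `<=` M) f,
    resM h1 (resM h0 f) = resM h f;
  resBBM : forall (X : topologicalType) (W W0 : bordism R n X)
      (M : cmanifold R n X)
      (h0 : subbordism W0 W) (h1 : M `<=` W0) (h : M `<=` W) f,
    resBM h1 (resB h0 f) = resBM h f;
  resBMM : forall (X : topologicalType) (W : bordism R n X)
      (M M0 : cmanifold R n X) (h0 : M `<=` W) (h1 : M0 `<=` M)
      (h : M0 `<=` W) f,
    resM h1 (resBM h0 f) = resBM h f;

  pullB : forall (X Y : topologicalType) (W : bordism R n X)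
    (W' : bordism R n Y), bhomeo W W' -> fldB W' -> fldB W;
  pullM : forall (X Y : topologicalType) (M : cmanifold R n X)
    (M' : cmanifold R n Y), homeo M M' -> fldM M' -> fldM M;
  pullB_bij : forall (X Y : topologicalType) (W : bordism R n X)
    (W' : bordism R n Y) (phi : bhomeo W W'), bijective (pullB phi);
  pullM_bij : forall (X Y : topologicalType) (M : cmanifold R n X)
    (M' : cmanifold R n Y) (phi : homeo M M'), bijective (pullM phi);
  (* identities and composites are characterized by their underlying maps *)
  pullB_id : forall (X : topologicalType) (W : bordism R n X)
      (phi : bhomeo W W), phi =1 id -> forall f, pullB phi f = f;
  pullM_id : forall (X : topologicalType) (M : cmanifold R n X)
      (phi : homeo M M), phi =1 id -> forall f, pullM phi f = f;
  pullB_comp : forall (X Y Z : topologicalType) (W : bordism R n X)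
      (W' : bordism R n Y) (W'' : bordism R n Z) (phi : bhomeo W W')
      (psi : bhomeo W' W'') (chi : bhomeo W W''),
    chi =1 psi \o phi -> forall f, pullB chi f = pullB phi (pullB psi f);
  pullM_comp : forall (X Y Z : topologicalType) (M : cmanifold R n X)
      (M' : cmanifold R n Y) (M'' : cmanifold R n Z) (phi : homeo M M')
      (psi : homeo M' M'') (chi : homeo M M''),
    chi =1 psi \o phi -> forall f, pullM chi f = pullM phi (pullM psi f);
  (* in the next three fields [phi0] is the restriction of [phi] *)
  pull_resB : forall (X Y : topologicalType) (W W0 : bordism R n X)
      (W' W0' : bordism R n Y) (phi : bhomeo W W') (phi0 : bhomeo W0 W0')
      (h : subbordism W0 W) (h' : subbordism W0' W'),
    (forall (x : W) (x0 : W0), val x = val x0 -> val (phi x) = val (phi0 x0)) ->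
    forall f, resB h (pullB phi f) = pullB phi0 (resB h' f);
  pull_resM : forall (X Y : topologicalType) (M M0 : cmanifold R n X)
      (M' M0' : cmanifold R n Y) (phi : homeo M M') (phi0 : homeo M0 M0')
      (h : M0 `<=` M) (h' : M0' `<=` M'),
    (forall (x : M) (x0 : M0), val x = val x0 -> val (phi x) = val (phi0 x0)) ->
    forall f, resM h (pullM phi f) = pullM phi0 (resM h' f);
  pull_resBM : forall (X Y : topologicalType) (W : bordism R n X)
      (M : cmanifold R n X) (W' : bordism R n Y) (M' : cmanifold R n Y)
      (phi : bhomeo W W') (phi0 : homeo M M') (h : M `<=` W) (h' : M' `<=` W'),
    (forall (x : W) (x0 : M), val x = val x0 -> val (phi x) = val (phi0 x0)) ->
    forall f, resBM h (pullB phi f) = pullM phi0 (resBM h' f);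

  (* restriction to [W], identified with its copy inside the disjoint union
     by the canonical homeomorphism *)
  res_inlB := (fun (X Y : topologicalType) (W : bordism R n X)
      (W' : bordism R n Y) (f : fldB (b_sum W W')) =>
    pullB (image_bhomeo (dinl_open X Y) W) (resB (b_inl_sub W W') f) : fldB W);
  res_inrB := (fun (X Y : topologicalType) (W : bordism R n X)
      (W' : bordism R n Y) (f : fldB (b_sum W W')) =>
    pullB (image_bhomeo (dinr_open X Y) W') (resB (b_inr_sub W W') f) : fldB W');
  res_inlM := (fun (X Y : topologicalType) (M : cmanifold R n X)
      (N : cmanifold R n Y) (f : fldM (cm_sum M N)) =>
    pullM (M' := cm_inl Y M) (image_homeo (dinl_open X Y) M)
      (resM (@cm_inl_sub R n X Y M N) f) : fldM M);
  res_inrM := (fun (X Y : topologicalType) (M : cmanifold R n X)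
      (N : cmanifold R n Y) (f : fldM (cm_sum M N)) =>
    pullM (M' := cm_inr X N) (image_homeo (dinr_open X Y) N)
      (resM (@cm_inr_sub R n X Y M N) f) : fldM N);
  fld_disjB : forall (X Y : topologicalType) (W : bordism R n X)
      (W' : bordism R n Y),
    bijective (fun f : fldB (b_sum W W') => (res_inlB f, res_inrB f));
  fld_disjM : forall (X Y : topologicalType) (M : cmanifold R n X)
      (N : cmanifold R n Y),
    bijective (fun f : fldM (cm_sum M N) => (res_inlM f, res_inrM f));

  (* bijectivity of the map from [fldB W] to the pullback
     [fldB W' x_(fldM N) fldB W''] *)
  fld_glue : forall (X : topologicalType) (N : cmanifold R n X)
      (W W' W'' : bordism R n X) (g : is_gluing N W W' W'')
      (f' : fldB W') (f'' : fldB W''),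
    resBM (gluing_midl g) f' = resBM (gluing_midr g) f'' ->
    exists! f : fldB W,
      resB (gluing_subl g) f = f' /\ resB (gluing_subr g) f = f'' }.

Section ActionExponentials.
Variables (R : realType) (n : nat) (F : field_system R n).
Variables (D : category) (S : strict_monoidal D).

Definition exponentials :=
  forall (X : topologicalType) (W : bordism R n X), fldB F W -> mor D.

Record is_action_exponential (T : exponentials) : Prop := IsActionExponential {
  act_empty : forall (X : topologicalType) (W : bordism R n X) (p : fldB F W),
    bpts W = set0 -> T X W p = Mor (idm (unit_ob S));
  act_disj : forall (X Y : topologicalType) (W : bordism R n X)
      (W' : bordism R n Y) (f : fldB F (b_sum W W')),
    T _ (b_sum W W') f =
    tens_mor S (T _ W (res_inlB f)) (T _ W' (res_inrB f));
  act_glue : forall (X : topologicalType) (N : cmanifold R n X)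
      (W W' W'' : bordism R n X) (g : is_gluing N W W' W'') (f : fldB F W),
    is_comp (T _ W'' (resB (gluing_subr g) f)) (T _ W' (resB (gluing_subl g) f))
      (T _ W f);
  act_homeo : forall (X Y : topologicalType) (W : bordism R n X)
      (W' : bordism R n Y) (phi : bhomeo W W') (f : fldB F W'),
    T _ W (pullB phi f) = T _ W' f }.

End ActionExponentials.

Definition linearization (R : realType) (n : nat) (F : field_system R n)
    (C D : category) (L : functor C D) (T : exponentials F C) :
  exponentials F D := fun X W f => fmor L (T X W f).

(* Main.v *)
Require Import Defs.
From HB Require Import structures.
From mathcomp Require Import all_boot all_order all_algebra.
From mathcomp Require Import all_classical all_reals.
From mathcomp Require Import topology.

(** Every axiom of action exponentials is an identity between morphisms built
    from the identity of the unit object, the tensor product of morphisms and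
    composition, and these are exactly the operations that a strict monoidal
    functor preserves.  Applying the functor to the axioms for [T] therefore
    yields the axioms for its linearization: preservation of the unit gives the
    value on empty bordisms, preservation of tensor products gives the value on
    disjoint unions, and functoriality ([is_comp_fmor]) gives the value on
    glued bordisms; homeomorphism invariance passes through any function of
    morphisms.  The argument takes place in an arbitrary strict monoidal target
    ([linearization_is_action_exponential]). *)

(** Strictness is what makes this an equality in [mor D], where sources and
    targets are compared too: the objects [fob L (unit_ob SC)] and
    [unit_ob SD] have to be equal, an isomorphism would not suffice. *)
Lemma fmor_id_unit (C D : category) (SC : strict_monoidal C)
    (SD : strict_monoidal D) (L : functor C D) :
  fob L (unit_ob SC) = unit_ob SD ->
  fmor L (Mor (idm (unit_ob SC))) = Mor (idm (unit_ob SD)).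
Proof. by move=> <-; rewrite /fmor /= fhom_id. Qed.

Lemma is_comp_fmor (C D : category) (L : functor C D) (g f h : mor C) :
  is_comp g f h -> is_comp (fmor L g) (fmor L f) (fmor L h).
Proof.
(* destructing the relation makes the target of [f] and the source of [g]
   syntactically the same object, so that [fhom_comp] applies *)
by case=> x y z g' f'; rewrite /fmor /= fhom_comp.
Qed.

Lemma linearization_is_action_exponential (R : realType) (n : nat)
    (F : field_system R n) (C D : category) (SC : strict_monoidal C)
    (SD : strict_monoidal D) (L : functor C D) (T : exponentials F C) :
  strict_monoidal_functor SC SD L -> is_action_exponential SC T ->
  is_action_exponential SD (linearization L T).
Proof.
case=> L1 _ LM [T0 TM TG TH]; rewrite /linearization; split.
- by move=> X W p W0; rewrite T0 //; exact: fmor_id_unit.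
- by move=> X Y W W' f; rewrite TM LM.
- by move=> X N W W' W'' g f; exact/is_comp_fmor/TG.
- by move=> X Y W W' phi f; rewrite TH.
Qed.

Theorem proposition8p1 (R : realType) (n : nat) (K : fieldType)
    (VectT : strict_tensor K)
    (C : category) (CT : strict_monoidal C)
    (L : functor C (Vect K))
    (L_strict : strict_monoidal_functor CT (st_monoidal VectT) L)
    (F : field_system R n) (T : exponentials F C)
    (T_act : is_action_exponential CT T) :
  is_action_exponential (st_monoidal VectT) (linearization L T).
Proof. exact: linearization_is_action_exponential L_strict T_act. Qed.
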